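(* Let $\Lambda^*$ be a standardized Lévy measure on $\mathbb R^d$ and let $U_i$ and $U_i'$, $i\in V=\{1,\dots,d\}$, be two sets of marginal tail functions, defining together with $\Lambda^*$ two Lévy measures $\Lambda$ and $\Lambda'$, respectively. Assume that all $U_i(x)$ and $U_i'(x)$ are continuous (in $x\neq 0$) and explode (tend to $\infty$) as $x\to\pm0$. Then, for disjoint $A,B,C\subseteq V$, $$A\perp B\mid C\;[\Lambda]\quad\Longleftrightarrow\quad A\perp B\mid C\;[\Lambda'].$$
   Context: A Lévy measure on $\mathbb R^d$ is a measure $\Lambda$ with $\Lambda(\{0\})=0$ and $\int(1\wedge\|x\|^2)\Lambda(dx)<\infty$. For $s\in\{+,-\}^d$ (identified with signs $\pm1$) let $\mathcal O_s=\{x\in\mathbb R^d: \text{for every } i,\ s_ix_i>0,\text{ or } x_i=0 \text{ if } s_i=+\}$. Marginal tail function of a one-dimensional Lévy measure $\Lambda_i$: $U_i(x)=\Lambda_i(\{y\ge x\})$ for $x\ge0$ (with $U_i(0)=\infty$ in the explosive case) and $U_i(x)=\Lambda_i(\{y\le x\})$ for $x<0$. A standardized Lévy measure is a Lévy measure $\Lambda^*$ on $\mathbb R^d$ with $\Lambda^*(\{y:y_i>x\})=\Lambda^*(\{y:y_i<-x\})=1/x$ for all $x>0$, $i\in V$. A standardized Lévy measure $\Lambda^*$ and marginal tail functions $U_1,\dots,U_d$ of one-dimensional Lévy measures define a Lévy measure $\Lambda$ on $\mathbb R^d$ by $$\Lambda(\{y: s_iy_i\ge s_ix_i,\ i\in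 V\})=\Lambda^*(\{y: s_iy_i\ge 1/U_i(x_i),\ i\in V\}),\qquad x\in\mathcal O_s,\ s\in\{+,-\}^d,$$ with $1/\infty=0$ and $1/0=\infty$. Conditional independence for $\Lambda$: for non-empty $D\subseteq V$ let $\Lambda_D=\Lambda(\{x:x_D\in\cdot\})$ on $\mathbb R^D\setminus\{0_D\}$. Let $\mathcal R(\Lambda_D)$ be the class of product sets $R=\times_{v\in D}R_v$ with $R_v\in\mathcal B(\mathbb R)$, $0\notin\overline R$, $\Lambda_D(R)>0$. For disjoint $A,B,C\subseteq V$ with $D=A\cup B\cup C$, $A\perp B\mid C\;[\Lambda]$ means that for every $R\in\mathcal R(\Lambda_D)$ a random vector $Y$ with law $\Lambda_D(\cdot\cap R)/\Lambda_D(R)$ satisfies the classical conditional independence $Y_A\perp\!\!\!\perp Y_B\mid Y_C$ (trivially true if $A$ or $B$ is empty; independence of $Y_A,Y_B$ if $C=\emptyset$). *)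

(* Defs.v *)
From HB Require Import structures.
From mathcomp Require Import all_boot all_order all_algebra.
From mathcomp Require Import all_classical all_reals all_analysis.
Import Order.TTheory GRing.Theory Num.Theory.
Import numFieldNormedType.Exports.

Set Implicit Arguments.
Unset Strict Implicit.
Unset Printing Implicit Defensive.

Local Open Scope classical_set_scope.
Local Open Scope ring_scope.

(* R^d is d.-tuple R with the library's product sigma-algebra, and
   V = {1, ..., d} is 'I_d. *)

Definition is_levy (R : realType) (d : nat)
    (L : {measure set (d.-tuple R) -> \bar R}) : Prop :=
  L [set [tuple 0 | _ < d]] = 0%E /\
  (\int[L]_x (Num.min 1 (\sum_(i < d) tnth x i ^+ 2))%:E < +oo)%E.

(* The case d = 1, on R rather than on 1.-tuple R. *)
Definition is_levy1 (R : realType) (M : {measure set R -> \bar R}) : Prop :=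
  M [set 0] = 0%E /\ (\int[M]_x (Num.min 1 (x ^+ 2))%:E < +oo)%E.

(* If the tail explodes at 0+, then U 0 = M [0, +oo[ = +oo. *)
Definition is_tail_function (R : realType) (U : R -> \bar R) : Prop :=
  exists M : {measure set R -> \bar R},
    is_levy1 M /\
    forall x, U x = if 0 <= x then M [set y | x <= y] else M [set y | y <= x].

Definition is_standardized_levy (R : realType) (d : nat)
    (L : {measure set (d.-tuple R) -> \bar R}) : Prop :=
  is_levy L /\
  forall (i : 'I_d) (x : R), 0 < x ->
    L [set y | x < tnth y i] = (x^-1)%:E /\
    L [set y | tnth y i < - x] = (x^-1)%:E.

(* Sign vectors are boolean: s i = false stands for + and s i = true for -,
   so that the sign s_i is (-1) ^+ s i. *)
Definition orthant (R : realType) (d : nat) (s : 'I_d -> bool) :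
    set (d.-tuple R) :=
  [set x | forall i, 0 < (-1) ^+ s i * tnth x i \/ (tnth x i = 0 /\ ~~ s i)].

(* The inverse on \bar R satisfies +oo^-1 = 0 and 0^-1 = +oo. *)
Definition defines_levy (R : realType) (d : nat)
    (Ls : {measure set (d.-tuple R) -> \bar R}) (U : 'I_d -> R -> \bar R)
    (L : {measure set (d.-tuple R) -> \bar R}) : Prop :=
  is_levy L /\
  forall (s : 'I_d -> bool) (x : d.-tuple R), orthant s x ->
    L [set y | forall i, (-1) ^+ s i * tnth x i <= (-1) ^+ s i * tnth y i] =
    Ls [set y | forall i,
          ((U i (tnth x i))^-1 <= ((-1) ^+ s i * tnth y i)%:E)%E].

(* The subvector x_J, as a tuple indexed by the positions in enum J. *)
Definition subvec (R : realType) (n : nat) (J : {set 'I_n}) (x : n.-tuple R) :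
    #|J|.-tuple R :=
  [tuple tnth x (enum_val k) | k < #|J|].

(* g is a version of z |-> P(E | Z = z), i.e. g o Z is a version of P(E | Z). *)
Definition is_cond_prob d d3 (T : measurableType d) (T3 : measurableType d3)
    (R : realType) (P : probability T R) (Z : T -> T3) (E : set T)
    (g : T3 -> R) : Prop :=
  [/\ measurable_fun setT g,
      P.-integrable setT (EFin \o (g \o Z)) &
      forall H, measurable H ->
        (\int[P]_(w in Z @^-1` H) (g (Z w))%:E = P (E `&` Z @^-1` H))%E].

(* Versions are unique up to P-null sets, so this is
   P(X in E, Y in F | Z) = P(X in E | Z) P(Y in F | Z) almost surely. *)
Definition cond_indep d d1 d2 d3 (T : measurableType d)
    (T1 : measurableType d1) (T2 : measurableType d2) (T3 : measurableType d3)
    (R : realType) (P : probability T R)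
    (X : T -> T1) (Y : T -> T2) (Z : T -> T3) : Prop :=
  forall (E : set T1) (F : set T2), measurable E -> measurable F ->
    exists f g : T3 -> R,
      [/\ is_cond_prob P Z (X @^-1` E) f,
          is_cond_prob P Z (Y @^-1` F) g &
          is_cond_prob P Z (X @^-1` E `&` Y @^-1` F) (f \* g)].

(* L_D; only its values on sets avoiding 0_D matter below. *)
Definition levy_marginal (R : realType) (d : nat)
    (L : {measure set (d.-tuple R) -> \bar R}) (D : {set 'I_d}) :
    set (#|D|.-tuple R) -> \bar R :=
  pushforward L (subvec D).
Arguments levy_marginal {R d} L D _.

(* The closure is taken in 'rV[R]_n, since tuples carry no topology. *)
Definition is_test_box (R : realType) (n : nat)
    (M : set (n.-tuple R) -> \bar R) (B : set (n.-tuple R)) : Prop :=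
  [/\ exists S : 'I_n -> set R,
        (forall k, measurable (S k)) /\
        B = [set y | forall k, S k (tnth y k)],
      ~ closure [set v : 'rV[R]_n | B [tuple v ord0 k | k < n]] 0 &
      (0 < M B)%E].

Definition levy_cond_indep (R : realType) (d : nat)
    (L : {measure set (d.-tuple R) -> \bar R}) (A B C : {set 'I_d}) : Prop :=
  let D := A :|: B :|: C in
  (* the positions of the elements of J in enum D *)
  let pos (J : {set 'I_d}) : {set 'I_#|D|} :=
    (fun k : 'I_#|D| => enum_val k) @^-1: J in
  forall Q : set (#|D|.-tuple R), is_test_box (levy_marginal L D) Q ->
  forall (d0 : measure_display) (T : measurableType d0) (P : probability T R)
    (Y : {RV P >-> #|D|.-tuple R}),
    (forall E, measurable E ->
       distribution P Y E =
       (levy_marginal L D (E `&` Q) / levy_marginal L D Q)%E) ->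
    cond_indep P (subvec (pos A) \o Y) (subvec (pos B) \o Y)
      (subvec (pos C) \o Y).

(* Main.v *)
Require Import Defs.
From HB Require Import structures.
From mathcomp Require Import all_boot all_order all_algebra.
From mathcomp Require Import all_classical all_reals all_analysis.
From mathcomp Require Import measurable_realfun.
Import Order.TTheory GRing.Theory Num.Theory.
Import numFieldNormedType.Exports.

Set Implicit Arguments.
Unset Strict Implicit.
Unset Printing Implicit Defensive.

Local Open Scope classical_set_scope.
Local Open Scope ring_scope.

(** Both measures are images of the standardized one.  Let phi_i be the
    quantile function of U_i: for y > 0, phi_i y is the largest x > 0 with
    U_i x >= 1/y; it is defined symmetrically for y < 0, and phi_i 0 = 0.  Then
    y >= 1 / U_i x exactly when phi_i y >= x ([half_line_quantile]), so the
    relation defining L says that L and the image of Ls under the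
    coordinatewise map phi agree on all corners (products of closed half-lines
    pointing away from 0).  Corners, together with the empty set and the
    origin, form a generating pi-system, and countably many of them, of finite
    measure for L, cover the space; hence L is the image of Ls under phi
    ([levy_quantile]).

    Continuity of U_i makes phi_i injective: U_i (phi_i y) = 1/|y|, so that
    psi_i x = sgn x / U_i x is a left inverse of phi_i ([inverse_tailK]).
    Writing phi' and psi' for the maps attached to U', the coordinatewise map
    tau = phi o psi' carries L' to L, and tau' = phi' o psi undoes it L'-almost
    everywhere, because L' lives on the range of phi', on which
    tau' o tau o phi' = phi' by cancellation.

    Conditional independence survives such a change of coordinates
    ([levy_cond_indep_transfer]).  If Q' is a test box for L', then its
    preimage Q under tau' is again a product set; it charges L as Q' charges
    L'; and it stays away from 0 because tau' 0 = 0 and, by explosion of the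
    tails, tau' is continuous at 0 ([quantile_inverse_tail_continuous0]).  A
    vector Y with the law of L' given Q' is turned by tau into a vector with
    the law of L given Q, and since Y_J and tau (Y_J) are almost surely
    functions of each other they generate the same conditional probabilities.
    The statement is symmetric in L and L'. *)

(** * Conditional probabilities under a change of variables *)

Lemma measurable_preimageT d d' (T : measurableType d) (T' : measurableType d')
    (f : T -> T') (E : set T') :
  measurable_fun setT f -> measurable E -> measurable (f @^-1` E).
Proof. by move=> mf mE; rewrite -[X in measurable X]setTI; apply: mf. Qed.

Lemma ae_eq_integral_set d (T : measurableType d) (R : realType)
    (mu : {measure set T -> \bar R}) (D D' : set T) (f : T -> \bar R) :
  measurable D -> measurable D' -> measurable_fun setT f ->
  {ae mu, forall w, D w <-> D' w} ->
  (\int[mu]_(w in D) f w = \int[mu]_(w in D') f w)%E.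
Proof.
move=> mD mD' mf DD'.
rewrite [LHS]integral_mkcond [RHS]integral_mkcond.
apply: ae_eq_integral => //.
- apply/(measurable_restrict _ _ _).1 => //.
  exact: measurable_funS mf.
- apply/(measurable_restrict _ _ _).1 => //.
  exact: measurable_funS mf.
apply: filterS DD' => w DD' _; rewrite /patch.
by have -> : (w \in D) = (w \in D') by apply/idP/idP; rewrite !inE DD'.
Qed.

Lemma ae_eq_measure d (T : measurableType d) (R : realType)
    (mu : {measure set T -> \bar R}) (D D' : set T) :
  measurable D -> measurable D' ->
  {ae mu, forall w, D w <-> D' w} -> mu D = mu D'.
Proof.
move=> mD mD' DD'.
rewrite -[D]setTI -[D']setTI -!integral_indic//.
by apply: ae_eq_integral_set => //; apply/measurable_EFinP;
  exact: measurable_indic.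
Qed.

(** Since [Z] and [u \o Z] determine each other almost surely, the events
    [Z @^-1` H] and [(u \o Z) @^-1` (v @^-1` H)] differ by a null set, so both
    variables condition on the same information. *)
Lemma is_cond_prob_transfer d d1 d2 (T : measurableType d)
    (S : measurableType d1) (S' : measurableType d2) (R : realType)
    (P : probability T R) (Z : T -> S) (u : S -> S') (v : S' -> S)
    (E E' : set T) (g : S' -> R) :
  measurable_fun setT Z -> measurable_fun setT u -> measurable_fun setT v ->
  measurable E -> measurable E' ->
  {ae P, forall w, v (u (Z w)) = Z w} ->
  {ae P, forall w, E' w <-> E w} ->
  is_cond_prob P (u \o Z) E' g -> is_cond_prob P Z E (g \o u).
Proof.
move=> mZ mu mv mE mE' vuZ EE' [mg ig gE]; split => //.
  exact: measurableT_comp.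
move=> H mH.
have mZH := measurable_preimageT mZ mH; have mvH := measurable_preimageT mv mH.
have muZH := measurable_preimageT (measurableT_comp mu mZ) mvH.
transitivity (P (E' `&` (u \o Z) @^-1` (v @^-1` H))).
  rewrite -gE//; apply: ae_eq_integral_set => //.
  - apply/measurable_EFinP; apply: measurableT_comp => //.
    exact: measurableT_comp.
  - by apply: filterS vuZ => w vuZ; rewrite /= vuZ.
apply: ae_eq_measure; [exact: measurableI|exact: measurableI|].
by apply: filterS2 vuZ EE' => w vuZ EE'; rewrite /= vuZ EE'.
Qed.

(** Versions for the original variables are obtained by composing those for
    the recoded ones with [u3]; composition commutes with the product in the
    definition. *)
Lemma cond_indep_transfer d d1 d2 d3 e1 e2 e3 (T : measurableType d)
    (S1 : measurableType d1) (S2 : measurableType d2) (S3 : measurableType d3)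
    (S1' : measurableType e1) (S2' : measurableType e2)
    (S3' : measurableType e3)
    (R : realType) (P : probability T R)
    (X : T -> S1) (Y : T -> S2) (Z : T -> S3)
    (u1 : S1 -> S1') (v1 : S1' -> S1) (u2 : S2 -> S2') (v2 : S2' -> S2)
    (u3 : S3 -> S3') (v3 : S3' -> S3) :
  measurable_fun setT X -> measurable_fun setT Y -> measurable_fun setT Z ->
  measurable_fun setT u1 -> measurable_fun setT v1 ->
  measurable_fun setT u2 -> measurable_fun setT v2 ->
  measurable_fun setT u3 -> measurable_fun setT v3 ->
  {ae P, forall w, v1 (u1 (X w)) = X w} ->
  {ae P, forall w, v2 (u2 (Y w)) = Y w} ->
  {ae P, forall w, v3 (u3 (Z w)) = Z w} ->
  cond_indep P (u1 \o X) (u2 \o Y) (u3 \o Z) -> cond_indep P X Y Z.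
Proof.
move=> mX mY mZ mu1 mv1 mu2 mv2 mu3 mv3 K1 K2 K3 ci E F mE mF.
have mE' := measurable_preimageT mv1 mE.
have mF' := measurable_preimageT mv2 mF.
have [f [g [cf cg cfg]]] := ci _ _ mE' mF'.
have mXE := measurable_preimageT mX mE; have mYF := measurable_preimageT mY mF.
have mX' := measurableT_comp mu1 mX; have mY' := measurableT_comp mu2 mY.
have mXE' := measurable_preimageT mX' mE'.
have mYF' := measurable_preimageT mY' mF'.
exists (f \o u3), (g \o u3); split.
- apply: is_cond_prob_transfer cf => //; try exact: K3; try exact: mv3.
  by apply: filterS K1 => w; rewrite /= => ->.
- apply: is_cond_prob_transfer cg => //; try exact: K3; try exact: mv3.
  by apply: filterS K2 => w; rewrite /= => ->.
- apply: is_cond_prob_transfer cfg => //; try exact: K3; try exact: mv3.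
  + exact: measurableI.
  + exact: measurableI.
  + by apply: filterS2 K1 K2 => w; rewrite /= => -> ->.
Qed.

(** * Coordinatewise maps and the transfer of conditional independence *)

Definition coord_map (R : Type) (n : nat) (t : 'I_n -> R -> R)
    (x : n.-tuple R) : n.-tuple R := [tuple t k (tnth x k) | k < n].

Lemma subvec_coord_map (R : realType) (n : nat) (J : {set 'I_n})
    (t : 'I_n -> R -> R) (x : n.-tuple R) :
  subvec J (coord_map t x) = coord_map (t \o enum_val) (subvec J x).
Proof. by apply: eq_from_tnth => k; rewrite !tnth_mktuple. Qed.

Lemma measurable_coord_map (R : realType) (n : nat) (t : 'I_n -> R -> R) :
  (forall k, measurable_fun setT (t k)) -> measurable_fun setT (coord_map t).
Proof.
move=> mt; apply/measurable_fun_tnthP => k.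
rewrite (_ : _ \o _ = t k \o (fun x : n.-tuple R => tnth x k)).
  by apply: measurableT_comp => //; exact: measurable_tnth.
by apply/funext => x /=; rewrite tnth_mktuple.
Qed.

Lemma measurable_subvec (R : realType) (n : nat) (J : {set 'I_n}) :
  measurable_fun setT (@subvec R n J).
Proof.
apply/measurable_fun_tnthP => k.
rewrite (_ : _ \o _ = fun x : n.-tuple R => tnth x (enum_val k)).
  exact: measurable_tnth.
by apply/funext => x /=; rewrite tnth_mktuple.
Qed.

Lemma coord_map_comp (R : Type) (n : nat) (s t : 'I_n -> R -> R)
    (x : n.-tuple R) :
  coord_map s (coord_map t x) = coord_map (fun k => s k \o t k) x.
Proof. by apply: eq_from_tnth => k; rewrite !tnth_mktuple. Qed.

Lemma measurable_tuple_box (R : realType) (n : nat) (S : 'I_n -> set R) :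
  (forall k, measurable (S k)) ->
  measurable [set y : n.-tuple R | forall k, S k (tnth y k)].
Proof.
move=> mS.
rewrite (_ : [set _ | _] =
  \bigcap_(k in setT) ((fun y : n.-tuple R => tnth y k) @^-1` S k)); last first.
  by apply/seteqP; split=> y yS // k; [move=> _|]; exact: yS.
apply: fin_bigcap_measurable => // k _.
by apply: measurable_preimageT => //; exact: measurable_tnth.
Qed.

Lemma measurable_coord_map_fix (R : realType) (n : nat) (t : 'I_n -> R -> R) :
  (forall k, measurable_fun setT (t k)) ->
  measurable [set y : n.-tuple R | coord_map t y = y].
Proof.
move=> mt.
rewrite (_ : [set _ | _] =
  [set y : n.-tuple R | forall k, [set r | t k r = r] (tnth y k)]); last first.
  apply/seteqP; split=> y /=.
    by move=> ty k; rewrite -[in RHS]ty tnth_mktuple.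
  by move=> ty; apply: eq_from_tnth => k; rewrite tnth_mktuple.
apply: (@measurable_tuple_box R n (fun k => [set r | t k r = r])) => k.
rewrite (_ : [set _ | _] = setT `&` (t k \- id) @^-1` [set 0]).
  have mf : measurable_fun setT (t k \- id) by exact: measurable_funB.
  exact: mf.
rewrite setTI; apply/seteqP; split=> r /=; last exact: subr0_eq.
by rewrite /GRing.sub_fun /= => ->; exact: subrr.
Qed.

(** A map continuous at 0 and fixing 0 sends points close to 0 to points close
    to 0; this keeps the preimage of a test box away from the origin. *)
Lemma closure_box_preimage (R : realType) (n : nat) (t : 'I_n -> R -> R)
    (B : set (n.-tuple R)) :
  (forall k, t k 0 = 0) -> (forall k, {for 0, continuous (t k)}) ->
  closure [set v : 'rV[R]_n |
    (coord_map t @^-1` B) [tuple v ord0 k | k < n]] 0 ->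
  closure [set v : 'rV[R]_n | B [tuple v ord0 k | k < n]] 0.
Proof.
move=> t0 tc cl W [V V0 VW].
have [|v [/= Bv Vv]] := cl [set v : 'rV[R]_n |
    forall i j, V i j (t j (v ord0 j))].
  exists (fun i j => [set r | forall i', V i' j (t j r)]).
    move=> i j; rewrite mxE.
    have Vt i' : \forall r \near (0 : R), V i' j (t j r).
      by have := V0 i' j; rewrite mxE -{1}(t0 j); exact: tc.
    exact: (filter_forall _ Vt).
  by move=> N HN i j; apply: HN.
exists (\row_j t j (v ord0 j)); split => /=.
  rewrite (_ : [tuple _ | _ < n] =
    coord_map t [tuple v ord0 k | k < n])//.
  by apply: eq_from_tnth => k; rewrite !tnth_mktuple mxE.
by apply: VW => i j; rewrite mxE.
Qed.

(** The test box for [L] is the preimage of the given box under [t'], not its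
    image under [t]: preimages of products are products of measurable sets. *)
Lemma levy_cond_indep_transfer (R : realType) (d : nat)
    (L L' : {measure set (d.-tuple R) -> \bar R}) (t t' : 'I_d -> R -> R)
    (A B C : {set 'I_d}) :
  (forall k, measurable_fun setT (t k)) ->
  (forall k, measurable_fun setT (t' k)) ->
  (forall k, t' k 0 = 0) -> (forall k, {for 0, continuous (t' k)}) ->
  (forall E, measurable E -> L E = L' (coord_map t @^-1` E)) ->
  {ae L', forall x, coord_map t' (coord_map t x) = x} ->
  levy_cond_indep L A B C -> levy_cond_indep L' A B C.
Proof.
move=> mt mt' t'0 t'c LL' t't ci.
rewrite /levy_cond_indep; set D := A :|: B :|: C => /=.
move=> Q' [[S [mS Q'E]] Q'0 Q'pos] d0 T P Y hY.
pose tD (k : 'I_#|D|) := t (enum_val k).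
pose t'D (k : 'I_#|D|) := t' (enum_val k).
have mQ' : measurable Q' by rewrite Q'E; exact: measurable_tuple_box.
have mtf := measurable_coord_map mt.
have mtD : measurable_fun setT (coord_map tD).
  by apply: measurable_coord_map => k; exact: mt.
have mt'D : measurable_fun setT (coord_map t'D).
  by apply: measurable_coord_map => k; exact: mt'.
have msub := @measurable_subvec R d D.
have LD G : measurable G ->
    levy_marginal L D G = levy_marginal L' D (coord_map tD @^-1` G).
  move=> mG; rewrite /levy_marginal /pushforward LL'; last first.
    exact: measurable_preimageT.
  by congr (L' _); apply/seteqP; split => x; rewrite /= subvec_coord_map.
have LDae G G' : measurable G -> measurable G' ->
    (forall y, coord_map t'D (coord_map tD y) = y -> (G y <-> G' y)) ->
    levy_marginal L' D G = levy_marginal L' D G'.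
  move=> mG mG' GG'; rewrite /levy_marginal /pushforward.
  apply: (@ae_eq_measure _ _ _ L');
    [exact: measurable_preimageT|exact: measurable_preimageT|].
  apply: filterS t't => x t'tx; apply: GG'.
  by rewrite -!subvec_coord_map t'tx.
(* t carries L' to L, so conditioning L on Q matches conditioning L' on Q' *)
pose Q := coord_map t'D @^-1` Q'.
have mQ : measurable Q by exact: measurable_preimageT.
have QQ' G : measurable G -> levy_marginal L D (G `&` Q) =
    levy_marginal L' D ((coord_map tD @^-1` G) `&` Q').
  move=> mG; rewrite LD; last exact: measurableI.
  apply: LDae => [||y t'ty].
  - by apply: measurable_preimageT => //; exact: measurableI.
  - by apply: measurableI => //; exact: measurable_preimageT.
  - by rewrite /Q /= t'ty.
have QE : levy_marginal L D Q = levy_marginal L' D Q'.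
  by have := QQ' setT measurableT; rewrite preimage_setT !setTI.
have tbQ : is_test_box (levy_marginal L D) Q.
  split.
  - exists (fun k => t'D k @^-1` S k); split=> [k|].
      by apply: measurable_preimageT => //; exact: mt'.
    by rewrite /Q Q'E; apply/seteqP; split=> y /= yS k;
      have := yS k; rewrite tnth_mktuple.
  - move=> clQ; apply: Q'0; apply: (@closure_box_preimage _ _ t'D) clQ => k.
      exact: t'0.
    exact: t'c.
  - by rewrite QE.
have mY : measurable_fun setT Y by exact: measurable_funPT.
have mX : (coord_map tD \o Y : T -> _) \in mfun.
  by rewrite inE; exact: measurableT_comp.
pose X : {RV P >-> #|D|.-tuple R} := mfun_Sub mX.
have hX E : measurable E -> distribution P X E =
    (levy_marginal L D (E `&` Q) / levy_marginal L D Q)%E.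
  move=> mE; rewrite QE QQ'// -hY; last exact: measurable_preimageT.
  by rewrite /distribution /pushforward mfun_valP.
have fixY : {ae P, forall w, coord_map t'D (coord_map tD (Y w)) = Y w}.
  pose F := [set y | coord_map t'D (coord_map tD y) = y].
  have mF : measurable F.
    rewrite /F; under eq_set do rewrite coord_map_comp.
    apply: measurable_coord_map_fix => k.
    by apply: measurableT_comp; [exact: mt'|exact: mt].
  have FC0 : distribution P Y (~` F) = 0%E.
    rewrite hY; last exact: measurableC.
    rewrite (LDae _ set0) => [||//|y Fy].
    - by rewrite /levy_marginal /pushforward preimage_set0 measure0 mul0e.
    - by apply: measurableI => //; exact: measurableC.
    - by split=> // -[].
  exists (Y @^-1` ~` F); split => //.
  by apply: measurable_preimageT => //; exact: measurableC.
have := ci Q tbQ d0 T P X hX.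
rewrite mfun_valP -/D /=.
set pA := _ @^-1: A; set pB := _ @^-1: B; set pC := _ @^-1: C.
pose tJ (J : {set 'I_#|D|}) (k : 'I_#|J|) := tD (enum_val k).
pose t'J (J : {set 'I_#|D|}) (k : 'I_#|J|) := t'D (enum_val k).
have XJ J : subvec J \o (coord_map tD \o Y) =
    coord_map (@tJ J) \o (subvec J \o Y).
  by apply/funext => w; rewrite /= subvec_coord_map.
have mJ J : measurable_fun setT (subvec J \o Y).
  by apply: measurableT_comp => //; exact: measurable_subvec.
have mtJ J : measurable_fun setT (coord_map (@tJ J)).
  by apply: measurable_coord_map => k; exact: mt.
have mt'J J : measurable_fun setT (coord_map (@t'J J)).
  by apply: measurable_coord_map => k; exact: mt'.
have fixJ J : {ae P, forall w, coord_map (@t'J J) (coord_map (@tJ J)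
    ((subvec J \o Y) w)) = (subvec J \o Y) w}.
  apply: filterS fixY => w fixw.
  by rewrite /= -[in RHS]fixw !subvec_coord_map.
rewrite !XJ; exact: (cond_indep_transfer (mJ _) (mJ _) (mJ _)
  (mtJ _) (mt'J _) (mtJ _) (mt'J _) (mtJ _) (mt'J _)
  (fixJ _) (fixJ _) (fixJ _)).
Qed.

(** * Corners determine a measure *)

(** A tail function takes at [x] the mass of [half_line x].  The sign of [x]
    selects the direction, so that a tuple of apexes encodes both the orthant
    and the point of the defining relation of a Levy measure. *)
Definition half_line (R : realType) (x : R) : set R :=
  if 0 <= x then [set y | x <= y] else [set y | y <= x].

Lemma half_line_sign (R : realType) (x y : R) :
  half_line x y -> (0 <= y) = (0 <= x).
Proof.
rewrite /half_line; case: ifPn => /= x0; first exact: le_trans.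
by rewrite -ltNge in x0 => /le_lt_trans /(_ x0); rewrite ltNge => /negbTE.
Qed.

Lemma half_lineI (R : realType) (a b : R) : (0 <= a) = (0 <= b) ->
  exists c, half_line a `&` half_line b = half_line c.
Proof.
rewrite /half_line => ab; rewrite -ab; case: ifPn => a0.
  exists (Num.max a b); rewrite le_max a0 /=.
  by apply/seteqP; split=> y /=; rewrite ge_max; [move=> [-> ->]|move=> /andP].
exists (Num.min a b); rewrite le_min (negbTE a0) /=.
by apply/seteqP; split=> y /=; rewrite le_min; [move=> [-> ->]|move=> /andP].
Qed.

(** A nonzero rational is chosen whenever possible, so that the corners with
    rational apex other than the origin cover everything but the origin. *)
Lemma half_line_rat (R : realType) (y : R) :
  exists q : rat, half_line (ratr q) y /\ (y != 0 -> ratr q != 0 :> R).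
Proof.
rewrite /half_line; have [y0|y0|<-] := ltgtP 0 y.
- have [q] := rat_in_itvoo y0; rewrite in_itv /= => /andP[q0 qy].
  by exists q; rewrite (ltW q0) /= (ltW qy) gt_eqF.
- have [q] := rat_in_itvoo y0; rewrite in_itv /= => /andP[yq q0].
  by exists q; rewrite leNgt q0 /= (ltW yq) lt_eqF.
- by exists 0; rewrite rmorph0 lexx /= lexx eqxx.
Qed.

Definition corner (R : realType) (n : nat) (x : n.-tuple R) :
    set (n.-tuple R) :=
  [set y | forall k, half_line (tnth x k) (tnth y k)].

Definition origin (R : realType) (n : nat) : n.-tuple R := [tuple 0 | _ < n].

(** The origin is added because the only corner that contains it,
    [0, +oo[ x ... x [0, +oo[, may have infinite measure, which would leave
    no countable cover by sets of finite measure. *)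
Definition corners (R : realType) (n : nat) : set (set (n.-tuple R)) :=
  [set E | [\/ E = set0, E = [set origin R n] | exists x, E = corner x]].

(** Two corners in different orthants are disjoint; in the same orthant their
    intersection is the corner at the coordinatewise extreme apex. *)
Lemma corners_setI (R : realType) (n : nat) : setI_closed (@corners R n).
Proof.
move=> E F.
have pt (G : set (n.-tuple R)) : corners ([set origin R n] `&` G).
  have [Go|Go] := pselect (G (origin R n)).
    by constructor 2; apply/seteqP; split=> [y []//|y /= ->].
  by constructor 1; apply/seteqP; split=> [y [/= ->]//|].
move=> [->|->|[a ->]]; first by rewrite set0I; constructor 1.
  by move=> _; exact: pt.
move=> [->|->|[b ->]]; first by rewrite setI0; constructor 1.
  by rewrite setIC; exact: pt.
have [ab|] := pselect (forall k, (0 <= tnth a k) = (0 <= tnth b k)).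
  have /choice[c cE] := fun k => half_lineI (ab k).
  constructor 3; exists [tuple c k | k < n].
  apply/seteqP; split=> y.
    by move=> [ya yb] k; rewrite tnth_mktuple -cE; split; [exact: ya|exact: yb].
  by move=> yc; split=> k; have := yc k; rewrite tnth_mktuple -cE => -[].
move=> ab; constructor 1; apply/seteqP; split=> // y [ya yb]; apply: ab => k.
by rewrite -(half_line_sign (ya k)) -(half_line_sign (yb k)).
Qed.

Lemma measurable_half_line (R : realType) (x : R) : measurable (half_line x).
Proof.
by rewrite /half_line; case: ifPn => _;
  rewrite -?set_itvcy -?set_itvNyc; exact: measurable_itv.
Qed.

Lemma measurable_corner (R : realType) (n : nat) (x : n.-tuple R) :
  measurable (corner x).
Proof.
by apply: (@measurable_tuple_box R n (fun k => half_line (tnth x k))) => k;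
  exact: measurable_half_line.
Qed.

Lemma measurable_origin (R : realType) (n : nat) :
  measurable [set origin R n].
Proof.
rewrite (_ : [set _] =
    [set y : n.-tuple R | forall k, [set 0] (tnth y k)]); last first.
  apply/seteqP; split=> y /=; first by move=> -> k; rewrite tnth_mktuple.
  by move=> y0; apply: eq_from_tnth => k; rewrite y0 tnth_mktuple.
by apply: (@measurable_tuple_box R n (fun=> [set 0])) => k.
Qed.

(** The slab [half_line r] in direction [k] is the union of the corners whose
    apex is [r] in coordinate [k] and rational elsewhere, so coordinates are
    measurable for the generated sigma-algebra. *)
Lemma measurable_corners (R : realType) (n : nat) :
  measurable = <<s @corners R n >>.
Proof.
apply/seteqP; split; last first.
  apply: smallest_sub; first exact: sigma_algebra_measurable.
  move=> E [->|->|[x ->]]; [exact: measurable0|exact: measurable_origin|].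
  exact: measurable_corner.
pose T := g_sigma_algebraType (@corners R n).
(* the identity is measurable from the generated sigma-algebra, which is
   checked coordinate by coordinate *)
suff mid : measurable_fun setT (id : T -> n.-tuple R).
  by move=> E mE; have := mid measurableT _ mE; rewrite setTI.
apply/measurable_fun_tnthP => k.
have mhl r : measurable ((fun y : T => tnth y k) @^-1` half_line r).
  pose x (q : n.-tuple rat) :=
    [tuple if j == k then r else ratr (tnth q j) | j < n].
  rewrite (_ : _ @^-1` _ = \bigcup_q (corner (x q) : set T)).
    apply: countable_bigcupT_measurable => [|q]; first exact: countableP.
    by apply: sub_sigma_algebra; constructor 3; exists (x q).
  apply/seteqP; split=> y /=.
    move=> ry; have /choice[q qy] := fun j => half_line_rat (tnth y j).
    exists [tuple q j | j < n] => // j; rewrite !tnth_mktuple.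
    by have [->//|_] := eqVneq j k; exact: (qy j).1.
  by move=> [q _ /(_ k)]; rewrite tnth_mktuple eqxx.
apply: (measurability (@RGenCInfty.G R)) => [|/= _ [_] [r] -> <-].
  exact: RGenCInfty.measurableE.
rewrite setTI set_itvcy; have [r0|r0] := leP 0 r.
  by have := mhl r; rewrite /half_line r0.
(* for r < 0 only the half-lines pointing left are available *)
rewrite -[X in measurable X]setCK; apply: measurableC.
rewrite (_ : ~` _ = \bigcup_(q in [set q : rat | ratr q < r])
    ((fun y : T => tnth y k) @^-1` half_line (ratr q))).
  rewrite bigcup_mkcond; apply: bigcupT_measurable_rat => q.
  by case: ifPn => _; [exact: mhl|exact: measurable0].
apply/seteqP; split=> y /=.
  move=> /negP; rewrite -ltNge => /rat_in_itvoo[q].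
  rewrite in_itv /= => /andP[yq qr]; exists q => //=.
  by rewrite /half_line leNgt (lt_trans qr r0) /= ltW.
move=> [q /= qr]; rewrite /half_line leNgt (lt_trans qr r0) /= => yq.
by apply/negP; rewrite -ltNge (le_lt_trans yq).
Qed.

(** Infinite measure near the origin is why uniqueness is not immediate: the
    cover consists of the origin, which is a null set, and of the corners with
    rational apex different from the origin. *)
Lemma corner_measure_unique (R : realType) (n : nat)
    (m1 m2 : {measure set (n.-tuple R) -> \bar R}) :
  m1 [set origin R n] = 0%E -> m2 [set origin R n] = 0%E ->
  (forall x, m1 (corner x) = m2 (corner x)) ->
  (forall x, x != origin R n -> (m1 (corner x) < +oo)%E) ->
  forall E, measurable E -> m1 E = m2 E.
Proof.
move=> m10 m20 m12 m1oo.
pose x (q : n.-tuple rat) : n.-tuple R := [tuple ratr (tnth q k) | k < n].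
(* indices that code no usable rational apex repeat the origin *)
pose g (k : nat) : set (n.-tuple R) :=
  if unpickle k is Some q then
    if x q == origin R n then [set origin R n] else corner (x q)
  else [set origin R n].
apply: (@measure_unique _ _ _ (@corners R n) g).
- exact: measurable_corners.
- exact: corners_setI.
- move=> k; rewrite /g; case: (unpickle k) => [q|]; last by constructor 2.
  by case: ifPn => _; [constructor 2|constructor 3; exists (x q)].
- apply/seteqP; split=> // y _.
  have /choice[q qy] := fun j => half_line_rat (tnth y j).
  exists (pickle [tuple q j | j < n]) => //; rewrite /g pickleK.
  case: ifPn => [/eqP xo|_].
    apply: eq_from_tnth => k; apply/eqP.
    apply: contraT; rewrite [X in _ != X]tnth_mktuple => /(qy k).2.
    have := congr1 (fun z => tnth z k) xo.
    by rewrite !tnth_mktuple => ->; rewrite eqxx.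
  by move=> k; rewrite !tnth_mktuple; exact: (qy k).1.
- by move=> E [->|->|[z ->]]; rewrite ?measure0 ?m10 ?m20.
- move=> k; rewrite /g; case: (unpickle k) => [q|]; last by rewrite m10 ltry.
  by case: ifPn => [_|xo]; [rewrite m10 ltry|exact: m1oo].
Qed.

(** * Tail functions of explosive continuous Levy measures *)

Definition explosive_tail (R : realType) (U : R -> \bar R) : Prop :=
  [/\ is_tail_function U,
      forall x, x != 0 -> {for x, continuous U} &
      U x @[x --> 0^'+] --> +oo%E /\ U x @[x --> 0^'-] --> +oo%E].

(** Markov inequality: on [half_line x] the integrand is at least
    min(1, x^2). *)
Lemma levy1_half_line_fin (R : realType) (M : {measure set R -> \bar R})
    (x : R) :
  is_levy1 M -> x != 0 -> (M (half_line x) < +oo)%E.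
Proof.
move=> [_ Mfin] x0; pose c := Num.min 1 (x ^+ 2).
have c0 : 0 < c by rewrite lt_min ltr01 exprn_even_gt0.
have mh : measurable (half_line x) by exact: measurable_half_line.
have mf : measurable_fun setT (fun y : R => (Num.min 1 (y ^+ 2))%:E).
  apply/measurable_EFinP; apply: measurable_minr.
    exact: measurable_cst.
  exact: exprn_measurable.
have min0 y : 0 <= Num.min 1 (y ^+ 2) :> R by rewrite le_min ler01 sqr_ge0.
have f0 y : (0 <= (Num.min 1 (y ^+ 2))%:E :> \bar R)%E.
  by rewrite lee_fin; exact: min0.
have : (c%:E * M (half_line x) < +oo)%E.
  apply: le_lt_trans Mfin; rewrite -integral_cst//.
  apply: (@le_trans _ _ (\int[M]_(y in half_line x) (Num.min 1 (y ^+ 2))%:E)%E);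
    last exact: ge0_subset_integral.
  apply: ge0_le_integral => //.
  - by move=> y _; rewrite lee_fin ltW.
  - exact: measurable_funS mf.
  move=> y; rewrite /half_line lee_fin /c.
  case: (leP 0 x) => x0' /= xy; rewrite le_min ge_min lexx /= ge_min.
    by rewrite (@lerXn2r _ 2%N x y) ?orbT // nnegrE // (le_trans x0').
  rewrite -(sqrrN x) -(sqrrN y) (@lerXn2r _ 2%N (- x) (- y)) ?orbT //.
  - by rewrite nnegrE oppr_ge0 ltW.
  - by rewrite nnegrE oppr_ge0 (le_trans xy) // ltW.
  - by rewrite lerN2.
by case: (M (half_line x)) => [r||];
  rewrite ?ltry ?ltNyr // gt0_muley // lte_fin.
Qed.

Lemma half_line_trans (R : realType) (x y z : R) :
  half_line x y -> half_line y z -> half_line x z.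
Proof.
move=> xy; have := half_line_sign xy; move: xy; rewrite /half_line => xy ->.
by case: ifPn xy => /= _ xy yz; [exact: le_trans yz|exact: le_trans xy].
Qed.

Section tail.
Context (R : realType) (U : R -> \bar R) (hU : explosive_tail U).

Lemma tail_half_line : exists M : {measure set R -> \bar R},
  is_levy1 M /\ forall x, U x = M (half_line x).
Proof.
have [[M [ML UM]] _ _] := hU; exists M; split => // x.
by rewrite UM /half_line; case: ifP.
Qed.

Lemma tail_ge0 x : (0 <= U x)%E.
Proof. by have [M [_ ->]] := tail_half_line. Qed.

Lemma tail_fin (x : R) : x != 0 -> U x \is a fin_num.
Proof.
move=> x0; have [M [ML UM]] := tail_half_line.
by rewrite ge0_fin_numE ?tail_ge0 // UM levy1_half_line_fin.
Qed.

Lemma tail_le x y : half_line x y -> (U y <= U x)%E.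
Proof.
move=> xy; have [M [_ UM]] := tail_half_line; rewrite !UM.
apply: le_measure; rewrite ?inE; try exact: measurable_half_line.
by move=> z; exact: half_line_trans.
Qed.

(** The half-lines at sgn x * (n + 1) decrease to the empty set and have finite
    measure. *)
Lemma tail_vanish (x c : R) : x != 0 -> 0 < c ->
  exists2 r : R, 0 < r & (U (Num.sg x * r) < c%:E)%E.
Proof.
move=> x0 c0; have [M [ML UM]] := tail_half_line.
pose F (n : nat) := half_line (Num.sg x * n.+1%:R).
have sx0 n : Num.sg x * n.+1%:R != 0 :> R.
  by rewrite mulf_neq0 ?sgr_eq0 // pnatr_eq0.
have cvF : (M \o F) n @[n --> \oo] --> M (\bigcap_n F n).
  apply: nonincreasing_cvg_mu => [|n||n m nm].
  - exact: levy1_half_line_fin.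
  - exact: measurable_half_line.
  - by apply: bigcapT_measurable => n; exact: measurable_half_line.
  - apply/subsetPset => y; apply: half_line_trans; rewrite /half_line.
    case: (sgrP x) x0 => //= xs _; rewrite ?mul1r ?mulN1r.
      by rewrite ler0n /= ler_nat.
    by rewrite oppr_ge0 lern0 /= lerN2 ler_nat.
have F0 : \bigcap_n F n = set0.
  apply/seteqP; split=> // y Fy.
  pose k := Num.trunc `|y|.
  have := Fy k I; rewrite /F /half_line.
  have yk : `|y| < k.+1%:R by exact: truncnS_gt.
  case: (sgrP x) x0 => //= xs _; rewrite ?mul1r ?mulN1r.
    by rewrite ler0n /= leNgt (le_lt_trans (ler_norm y)).
  rewrite oppr_ge0 lern0 /= leNgt ltrNl (le_lt_trans _ yk) //.
  by rewrite -normrN ler_norm.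
rewrite F0 measure0 in cvF.
have /cvF[N _ /(_ N (leqnn N)) /= FN] :
    nbhs (0 : \bar R) [set z | (z < c%:E)%E].
  by apply: open_nbhs_nbhs; split;
    [exact: open_ereal_lt_ereal|rewrite /= lte_fin].
by exists N.+1%:R; rewrite ?ltr0n // UM.
Qed.

Lemma tail_explode (K : R) :
  exists2 e : R, 0 < e & forall x, x != 0 -> `|x| < e -> (K%:E < U x)%E.
Proof.
have [_ _ [U0p U0m]] := hU.
have oK : nbhs (+oo%E : \bar R) [set z | (K%:E < z)%E].
  by apply: open_nbhs_nbhs; split; [exact: open_ereal_gt_ereal|rewrite /= ltry].
have [e1 /= e10 he1] := U0p _ oK.
have [e2 /= e20 he2] := U0m _ oK.
exists (Num.min e1 e2); first by rewrite lt_min e10.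
move=> x x0; rewrite lt_min => /andP[xe1 xe2].
have [x0'|x0'|x0'] := ltgtP 0 x.
- by apply: he1 => //=; rewrite sub0r normrN.
- by apply: he2 => //=; rewrite sub0r normrN.
- by rewrite -x0' eqxx in x0.
Qed.

Lemma tail_near (x : R) (A : set (\bar R)) : x != 0 -> open A -> A (U x) ->
  exists2 e : R, 0 < e & forall z, `|z - x| < e -> A (U z).
Proof.
move=> x0 oA AU; have [_ cU _] := hU.
have [e e0 he] := cU x x0 A (open_nbhs_nbhs (conj oA AU)).
by exists e => // z zx; apply: he; rewrite /= distrC.
Qed.

Lemma tail0 : U 0 = +oo%E.
Proof.
apply/eqyP => K K0; have [e e0 he] := tail_explode K.
have e20 : 0 < e / 2 by rewrite divr_gt0.
apply: (@le_trans _ _ (U (e / 2))).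
  apply/ltW/he; rewrite ?gt_eqF // gtr0_norm //.
  by rewrite ltr_pdivrMr // ltr_pMr // ltr1n.
by apply: tail_le; rewrite /half_line lexx /= ltW.
Qed.

End tail.

(** * Quantile functions *)

(** Generalized inverse of x |-> sgn x / U x, with 1 / 0 read as +oo. *)
Definition quantile (R : realType) (U : R -> \bar R) (y : R) : R :=
  Num.sg y * sup [set r : R | 0 < r /\ (`|y|^-1%:E <= U (Num.sg y * r)%R)%E].

(** Where [U x] vanishes the value is 0, a convention that only affects points
    beyond the range of [quantile U]. *)
Definition inverse_tail (R : realType) (U : R -> \bar R) (x : R) : R :=
  Num.sg x * (fine (U x))^-1.

Section quantile.
Context (R : realType) (U : R -> \bar R) (hU : explosive_tail U).

(** The supremum q exists by explosion at 0 and decay at infinity.  Continuity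
    of the tail is used twice: from the left to see that q itself satisfies the
    defining inequality, from the right to see that it is an equality. *)
Lemma quantile_sup (y : R) : y != 0 ->
  exists q, [/\ 0 < q, quantile U y = Num.sg y * q,
    U (Num.sg y * q) = `|y|^-1%:E &
    forall r, 0 < r -> (r <= q) = (`|y|^-1%:E <= U (Num.sg y * r)%R)%E].
Proof.
move=> y0; set c := `|y|^-1; set e := Num.sg y.
have c0 : 0 < c by rewrite invr_gt0 normr_gt0.
have e1 : `|e| = 1 by rewrite normr_sg y0.
have e0 : e != 0 by rewrite sgr_eq0.
pose S := [set r : R | 0 < r /\ (c%:E <= U (e * r)%R)%E].
have mono r s : 0 < r -> r <= s -> (U (e * s)%R <= U (e * r)%R)%E.
  move=> r0 rs; have s0 := lt_le_trans r0 rs.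
  apply: (tail_le hU); rewrite /half_line /e; case: (sgrP y) y0 => //= _ _.
    by rewrite !mul1r ltW.
  by rewrite !mulN1r oppr_ge0 leNgt r0 /= lerN2.
have [r1 [r10 Sr1]] : exists r1, S r1.
  have [d d0 hd] := tail_explode hU c.
  exists (d / 2); split; first by rewrite divr_gt0.
  apply/ltW/hd; first by rewrite mulf_neq0 // gt_eqF // divr_gt0.
  rewrite normrM e1 mul1r gtr0_norm ?divr_gt0 //.
  by rewrite ltr_pdivrMr // ltr_pMr // ltr1n.
have [r2 r20 Sr2] := tail_vanish hU y0 c0.
have Sub : has_sup S.
  split; first by exists r1.
  exists r2 => r [r0 Sr]; rewrite leNgt; apply/negP => r2r.
  by have := lt_le_trans (le_lt_trans (mono _ _ r20 (ltW r2r)) Sr2) Sr;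
    rewrite ltxx.
have Sle r : S r -> r <= sup S by move=> Sr; exact: sup_upper_bound.
have q0 : 0 < sup S by exact: lt_le_trans (Sle r1 _).
have eq0 : e * sup S != 0 by rewrite mulf_neq0 // gt_eqF.
have near (s : R) d : `|s - sup S| < d -> `|e * s - e * sup S| < d.
  by rewrite -mulrBr normrM e1 mul1r.
have cq : (c%:E <= U (e * sup S)%R)%E.
  rewrite leNgt; apply/negP => Uq.
  have [d d0 hd] := tail_near hU eq0 (@open_ereal_lt_ereal R c%:E) Uq.
  have [s [s0 Ss] qs] := sup_adherent d0 Sub.
  have sq : s <= sup S by exact: Sle.
  have /hd /= : `|e * s - e * sup S| < d.
    by apply: near; rewrite ler0_norm ?subr_le0 // opprB ltrBlDr -ltrBlDl.
  by rewrite ltNge Ss.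
exists (sup S); split => //.
- apply/eqP; rewrite eq_le cq andbT leNgt; apply/negP => Uq.
  have [d d0 hd] := tail_near hU eq0 (@open_ereal_gt_ereal R c%:E) Uq.
  have d20 : 0 < d / 2 by rewrite divr_gt0.
  have /hd /= Ud : `|e * (sup S + d / 2) - e * sup S| < d.
    apply: near; rewrite addrAC subrr add0r gtr0_norm //.
    by rewrite ltr_pdivrMr // ltr_pMr // ltr1n.
  have : sup S + d / 2 <= sup S.
    by apply: Sle; split; [exact: addr_gt0|exact: ltW].
  by rewrite gerDl leNgt d20.
- move=> r r0; apply/idP/idP => [rq|cr].
    exact: le_trans (mono _ _ r0 rq).
  by apply: Sle.
Qed.

Lemma quantile0 : quantile U 0 = 0.
Proof. by rewrite /quantile sgr0 mul0r. Qed.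

Lemma quantile_neq0 (y : R) : y != 0 -> quantile U y != 0.
Proof.
move=> y0; have [q [q0 -> _ _]] := quantile_sup y0.
by rewrite mulf_neq0 ?sgr_eq0 // gt_eqF.
Qed.

Lemma tail_quantile (y : R) : y != 0 -> U (quantile U y) = `|y|^-1%:E.
Proof. by move=> y0; have [q [_ -> ]] := quantile_sup y0. Qed.

Lemma sgr_quantile (y : R) : Num.sg (quantile U y) = Num.sg y.
Proof.
have [->|y0] := eqVneq y 0; first by rewrite quantile0.
have [q [q0 -> _ _]] := quantile_sup y0.
by rewrite sgrM sgr_id (gtr0_sg q0) mulr1.
Qed.

(** The equality in [quantile_sup], that is, the absence of atoms, makes the
    quantile function injective. *)
Lemma inverse_tailK : cancel (quantile U) (inverse_tail U).
Proof.
move=> y; rewrite /inverse_tail sgr_quantile.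
have [->|y0] := eqVneq y 0; first by rewrite sgr0 mul0r.
by rewrite tail_quantile //= invrK -numEsg.
Qed.

(** Galois connection turning the relation that defines a Levy measure into a
    statement on preimages.  The exponent is the sign s_i of the orthant of
    [x]. *)
Lemma half_line_quantile (x y : R) :
  half_line x (quantile U y) <->
  ((U x)^-1 <= ((-1) ^+ (x < 0)%R * y)%:E)%E.
Proof.
rewrite /half_line ltNge.
have [-> | x0] := eqVneq x 0.
  rewrite lexx (tail0 hU) invey expr0 mul1r lee_fin /=.
  by rewrite -[_ <= quantile _ _]sgr_ge0 sgr_quantile sgr_ge0.
have Ux0 : (0 < (U x)^-1)%E.
  have := tail_fin hU x0; have := tail_ge0 hU x; case: inveP => // r r0.
  by rewrite !lee_fin lte_fin invr_gt0 lt_def r0.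
have [y0|y0] := eqVneq y 0.
  rewrite y0 quantile0 mulr0.
  have -> : ((U x)^-1 <= 0%:E)%E = false by rewrite leNgt Ux0.
  case: leP => /= xs; split=> // xs'; last by move: xs; rewrite ltNge xs'.
  by move: x0; rewrite eq_le xs' xs.
have [q [q0 qE _ qle]] := quantile_sup y0.
have Uy : ((U x)^-1 <= `|y|%:E)%E = (`|y|^-1%:E <= U x)%E.
  rewrite inve_ple ?inE ?(tail_ge0 hU) ?lee_fin //.
  by rewrite inver normr_eq0 (negbTE y0).
rewrite qE; have [xp|xn] := leP 0 x; rewrite /= ?expr0 ?expr1 ?mul1r ?mulN1r.
- have {}xp : 0 < x by rewrite lt_def x0.
  have [ys|ys|ys] := sgrP y.
  + by rewrite ys eqxx in y0.
  + move: (qle x xp); rewrite (gtr0_sg ys) !mul1r -Uy (gtr0_norm ys).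
    by move=> ->.
  + split.
      by rewrite mulN1r => /(lt_le_trans xp); rewrite oppr_gt0 ltNge ltW.
    by move=> /(lt_le_trans Ux0); rewrite lte_fin ltNge ltW.
- have [ys|ys|ys] := sgrP y.
  + by rewrite ys eqxx in y0.
  + split; first by rewrite mul1r => /le_lt_trans /(_ xn); rewrite ltNge ltW.
    by move=> /(lt_le_trans Ux0); rewrite lte_fin oppr_gt0 ltNge ltW.
  + have nx : 0 < - x by rewrite oppr_gt0.
    move: (qle _ nx); rewrite (ltr0_sg ys) !mulN1r opprK -Uy (ltr0_norm ys).
    by rewrite lerNl => ->.
Qed.

(** Monotonicity is read off the Galois connection at an apex
    x = quantile U w with w <> 0, where (U x)^-1 = |w|. *)
Lemma nondecreasing_quantile : nondecreasing_fun (quantile U).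
Proof.
have neg (y : R) : (quantile U y < 0) = (y < 0).
  by rewrite -sgr_lt0 sgr_quantile sgr_lt0.
have pos (y : R) : (0 < quantile U y) = (0 < y).
  by rewrite -sgr_gt0 sgr_quantile sgr_gt0.
move=> y z yz.
have [y0|y0|y0] := ltgtP 0 y.
- have z0 : 0 < z by exact: lt_le_trans yz.
  have qy : 0 < quantile U y by rewrite pos.
  have : half_line (quantile U y) (quantile U z).
    apply/half_line_quantile; rewrite tail_quantile ?gt_eqF // ltNge (ltW qy).
    rewrite expr0 mul1r inver invr_eq0 normr_eq0 gt_eqF //.
    by rewrite invrK gtr0_norm.
  by rewrite /half_line (ltW qy).
- have [z0|z0] := leP 0 z.
    by apply: (@le_trans _ _ 0); [rewrite ltW ?neg|rewrite leNgt neg -leNgt].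
  have qz : quantile U z < 0 by rewrite neg.
  have : half_line (quantile U z) (quantile U y).
    apply/half_line_quantile; rewrite tail_quantile ?lt_eqF // qz.
    rewrite expr1 mulN1r inver invr_eq0 normr_eq0 lt_eqF //.
    by rewrite invrK ltr0_norm // lee_fin lerN2.
  by rewrite /half_line leNgt qz.
- by rewrite -y0 quantile0 leNgt neg -leNgt y0.
Qed.

Lemma measurable_quantile : measurable_fun setT (quantile U).
Proof. exact: nondecreasing_measurable nondecreasing_quantile. Qed.

(** The tail is monotone on each side of 0, so its superlevel sets are unions
    of two intervals. *)
Lemma measurable_inverse_tail : measurable_fun setT (inverse_tail U).
Proof.
have mU : measurable_fun setT U.
  apply: (measurability (@ErealGenCInfty.G R)) => [|/= _ [_] [r] -> <-].
    exact: ErealGenCInfty.measurableE.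
  rewrite setTI.
  set E := _ @^-1` _.
  rewrite -(setIT E) -(setUv `[0, +oo[) setIUr.
  apply: measurableU; apply: is_interval_measurable => s t /=.
    rewrite /E /= !in_itv /= !andbT => -[rs s0] [rt t0] u /andP[su ut].
    split; rewrite in_itv /= andbT; last exact: le_trans su.
    apply: (le_trans rt); apply: (tail_le hU).
    by rewrite /half_line (le_trans s0 su).
  rewrite /E /= !in_itv /= !andbT.
  move=> -[rs /negP s0] [rt /negP t0] u /andP[su ut].
  have u0 : ~~ (0 <= u) by rewrite -!ltNge in t0 *; exact: le_lt_trans t0.
  split; rewrite in_itv /= andbT; last exact/negP.
  apply: (le_trans rs); apply: (tail_le hU).
  by rewrite /half_line (negbTE u0).
(* the power -1 agrees with the inverse on nonnegative reals, including at 0 *)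
rewrite (_ : inverse_tail U =
    (@Num.sg R) \* (fun x => fine (U x) `^ (-1))); last first.
  by apply/funext => x; rewrite /= powR_inv1 // fine_ge0 // tail_ge0.
apply: measurable_funM.
  apply: nondecreasing_measurable => // x y xy.
  have [x0|x0|x0] := sgrP x; have [y0|y0|y0] := sgrP y => //.
  - by move: xy; rewrite x0 leNgt y0.
  - by move: xy; rewrite y0 leNgt x0.
  - by have := lt_le_trans x0 xy; rewrite ltNge ltW.
apply: (measurableT_comp (measurable_powR _)).
by apply: (measurableT_comp _ mU); exact: fine_measurable.
Qed.

End quantile.

(** Near 0 the tail [U] exceeds any bound K; taking K at least U' e and
    U' (- e), the point [inverse_tail U x] is so small that its quantile
    under [U'] is below e. *)
Lemma quantile_inverse_tail_continuous0 (R : realType) (U U' : R -> \bar R) :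
  explosive_tail U -> explosive_tail U' ->
  {for 0, continuous (quantile U' \o inverse_tail U)}.
Proof.
move=> hU hU'.
have i0 : inverse_tail U 0 = 0 by rewrite /inverse_tail sgr0 mul0r.
rewrite /prop_for /continuous_at /= i0 quantile0.
apply/cvgrPdist_lt => /= e e0.
pose K := Num.max 1 (Num.max (fine (U' e)) (fine (U' (- e)))).
have [d d0 hd] := tail_explode hU K.
near=> x; rewrite sub0r normrN.
have [->|x0] := eqVneq x 0; first by rewrite i0 quantile0 normr0.
have Ux : (K%:E < U x)%E.
  by apply: hd => //; near: x; exact: nbhs0_lt.
have Uxf := tail_fin hU x0.
have K0 : 0 < K by rewrite lt_max ltr01.
have fU0 : 0 < fine (U x).
  by rewrite (lt_trans K0) // -lte_fin fineK.
have z0 : inverse_tail U x != 0.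
  by rewrite /inverse_tail mulf_neq0 ?sgr_eq0 // invr_eq0 gt_eqF.
(* e <= q would give 1 / |z| <= U' (sgn z * e) <= K for z = inverse_tail U x,
   whereas 1 / |z| = U x > K *)
have [q [q0 -> _ qle]] := quantile_sup hU' z0.
rewrite normrM normr_sg z0 mul1r gtr0_norm // ltNge qle // -ltNge.
rewrite {1}/inverse_tail normrM normr_sg x0 mul1r normfV invrK gtr0_norm //.
rewrite fineK //; apply: le_lt_trans Ux.
have e0' : e != 0 by rewrite gt_eqF.
rewrite -[X in (X <= _)%E]fineK; last first.
  by apply: tail_fin => //; rewrite mulf_neq0 // sgr_eq0.
rewrite lee_fin /K !le_max.
case: (sgrP (inverse_tail U x)) z0 => //= _ _.
  by rewrite mul1r lexx orbT.
by rewrite mulN1r lexx !orbT.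
Unshelve. all: by end_near. Qed.

(** * The Levy measure as an image of the standardized one *)

(** Finiteness of [L] on a corner with apex x, x_k <> 0, comes from the
    standardized margin: the corner is carried to a set on which
    |y_k| >= 1 / U_k x_k > 1 / (U_k x_k + 1).  The last bound is a positive real
    also when U_k x_k = 0. *)
Lemma levy_quantile (R : realType) (d : nat)
    (Ls L : {measure set (d.-tuple R) -> \bar R}) (U : 'I_d -> R -> \bar R) :
  is_standardized_levy Ls -> (forall k, explosive_tail (U k)) ->
  defines_levy Ls U L ->
  forall E, measurable E ->
    L E = Ls (coord_map (fun k => quantile (U k)) @^-1` E).
Proof.
move=> [[Ls0 _] Lstd] hU [[L0 _] LE].
pose q (k : 'I_d) := quantile (U k).
have mq : measurable_fun setT (coord_map q).
  by apply: measurable_coord_map => k; exact: measurable_quantile.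
have [m mE] : exists m : {measure set (d.-tuple R) -> \bar R},
    forall E, m E = Ls (coord_map q @^-1` E).
  have @m : {measure set (d.-tuple R) -> \bar R}.
    by refine (pushforward Ls (coord_map q)); exact: mq.
  by exists m.
have cornerE x : L (corner x) =
    Ls [set y | forall k, ((U k (tnth x k))^-1 <=
      ((-1) ^+ (tnth x k < 0)%R * tnth y k)%:E)%E].
  rewrite -LE; last first.
    move=> k; case: (ltgtP (tnth x k) 0) => xk; last by right.
      by left; rewrite mulN1r oppr_gt0.
    by left; rewrite mul1r.
  congr (L _); apply/seteqP; split => y xy k; have := xy k; rewrite /half_line;
    by case: leP => _ /=; rewrite ?mulN1r ?mul1r ?lerN2.
move=> E; rewrite -mE; move: E; apply: corner_measure_unique => //.
- rewrite mE (_ : _ @^-1` _ = [set origin R d]) //.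
  apply/seteqP; split=> y /=.
    move=> y0; apply: eq_from_tnth => k; rewrite tnth_mktuple; apply/eqP.
    apply: contraT => /(quantile_neq0 (hU k)).
    have := congr1 (fun z => tnth z k) y0.
    by rewrite !tnth_mktuple /q => ->; rewrite eqxx.
  by move=> ->; apply: eq_from_tnth => k; rewrite !tnth_mktuple /q quantile0.
- move=> x; rewrite cornerE mE; congr (Ls _).
  by apply/seteqP; split => y /= xy k; have := xy k; rewrite tnth_mktuple;
    move/(half_line_quantile (hU k)).
- move=> x xo; rewrite cornerE.
  have [k xk] : exists k, tnth x k != 0.
    apply/existsP; apply: contraNT xo; rewrite negb_exists => /forallP x0.
    apply/eqP/eq_from_tnth => k; rewrite tnth_mktuple.
    by apply/eqP; rewrite -[_ == _]negbK x0.
  pose v := fine (U k (tnth x k)).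
  have Uv : U k (tnth x k) = v%:E by rewrite fineK // tail_fin.
  have v0 : 0 <= v by rewrite fine_ge0 // tail_ge0.
  have v1 : 0 < v + 1 by rewrite ltr_wpDl.
  have vlt a : ((U k (tnth x k))^-1 <= a%:E)%E -> (v + 1)^-1 < a.
    rewrite Uv inver; case: eqP => // /eqP vn0; rewrite lee_fin.
    apply: lt_le_trans; rewrite ltf_pV2 ?posrE ?ltrDl // lt_def vn0 //.
  have c0 : 0 < (v + 1)^-1 by rewrite invr_gt0.
  have [Lp Ln] := Lstd k _ c0.
  pose G : set R := if tnth x k < 0 then [set a | a < - (v + 1)^-1]
    else [set a | (v + 1)^-1 < a].
  have mG : measurable G.
    by rewrite /G; case: ifPn => _; rewrite -?set_itvoy -?set_itvNyo;
      exact: measurable_itv.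
  have mcG : measurable [set y : d.-tuple R | G (tnth y k)].
    by apply: measurable_preimageT => //; exact: measurable_tnth.
  apply: (@le_lt_trans _ _ (Ls [set y | G (tnth y k)])).
    apply: le_measure; rewrite ?inE //.
      rewrite (_ : [set _ | _] = coord_map q @^-1` corner x).
        by apply: measurable_preimageT => //; exact: measurable_corner.
      by apply/seteqP; split => y /= xy j; have := xy j; rewrite tnth_mktuple;
        move/(half_line_quantile (hU j)).
    move=> y /(_ k) /vlt; rewrite /G /=; case: ifP => _ /=.
      by rewrite mulN1r ltrNr.
    by rewrite mul1r.
  by rewrite /G; case: ifP => _; rewrite ?Lp ?Ln ltry.
Qed.

(** The map phi' o psi inverts phi o psi' on the range of phi', which carries
    all the mass of L'. *)
Lemma levy_cond_indep_standardized (R : realType) (d : nat)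
    (Ls L L' : {measure set (d.-tuple R) -> \bar R})
    (U U' : 'I_d -> R -> \bar R) (A B C : {set 'I_d}) :
  is_standardized_levy Ls ->
  (forall k, explosive_tail (U k)) -> (forall k, explosive_tail (U' k)) ->
  defines_levy Ls U L -> defines_levy Ls U' L' ->
  levy_cond_indep L A B C -> levy_cond_indep L' A B C.
Proof.
move=> hLs hU hU' hL hL'.
pose t (k : 'I_d) := quantile (U k) \o inverse_tail (U' k).
pose t' (k : 'I_d) := quantile (U' k) \o inverse_tail (U k).
have mt k : measurable_fun setT (t k).
  by apply: measurableT_comp; [exact: measurable_quantile|
    exact: measurable_inverse_tail].
have mt' k : measurable_fun setT (t' k).
  by apply: measurableT_comp; [exact: measurable_quantile|
    exact: measurable_inverse_tail].
have LQ := levy_quantile hLs hU hL; have LQ' := levy_quantile hLs hU' hL'.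
apply: (levy_cond_indep_transfer (t := t) (t' := t')) => //.
- by move=> k; rewrite /t' /= /inverse_tail sgr0 mul0r quantile0.
- by move=> k; exact: quantile_inverse_tail_continuous0.
- move=> E mE; rewrite LQ // LQ'; last first.
    by apply: measurable_preimageT => //; exact: measurable_coord_map.
  congr (Ls _); rewrite -comp_preimage; congr (_ @^-1` E); apply/funext => y.
  apply: eq_from_tnth => k; rewrite /= !tnth_mktuple /t /=.
  by rewrite (inverse_tailK (hU' k)).
pose F := [set x : d.-tuple R | coord_map t' (coord_map t x) = x].
have mF : measurable F.
  rewrite /F; under eq_set do rewrite coord_map_comp.
  by apply: measurable_coord_map_fix => k; exact: measurableT_comp.
exists (~` F); split => //; first exact: measurableC.
rewrite LQ'; last exact: measurableC.
rewrite (_ : _ @^-1` _ = set0) ?measure0 //.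
apply/seteqP; split=> // y /= []; apply: eq_from_tnth => k.
rewrite !tnth_mktuple /t /t' /= (inverse_tailK (hU' k)).
by rewrite (inverse_tailK (hU k)).
Qed.

Theorem proposition4p4 (R : realType) (d : nat)
  (Ls L L' : {measure set (d.-tuple R) -> \bar R})
  (U U' : 'I_d -> R -> \bar R)
  (hLs : is_standardized_levy Ls)
  (hU : forall i, is_tail_function (U i))
  (hU' : forall i, is_tail_function (U' i))
  (hL : defines_levy Ls U L)
  (hL' : defines_levy Ls U' L')
  (hUc : forall (i : 'I_d) (x : R), x != 0 -> {for x, continuous (U i)})
  (hUc' : forall (i : 'I_d) (x : R), x != 0 -> {for x, continuous (U' i)})
  (hUe : forall i : 'I_d, U i x @[x --> 0^'+] --> +oo%E /\
                          U i x @[x --> 0^'-] --> +oo%E)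
  (hUe' : forall i : 'I_d, U' i x @[x --> 0^'+] --> +oo%E /\
                           U' i x @[x --> 0^'-] --> +oo%E)
  (A B C : {set 'I_d})
  (hAB : [disjoint A & B]%B) (hAC : [disjoint A & C]%B) (hBC : [disjoint B & C]%B) :
  levy_cond_indep L A B C <-> levy_cond_indep L' A B C.
Proof.
have tU i : explosive_tail (U i) by split; [|exact: hUc|].
have tU' i : explosive_tail (U' i) by split; [|exact: hUc'|].
split; first exact: (levy_cond_indep_standardized hLs tU tU' hL hL').
exact: (levy_cond_indep_standardized hLs tU' tU hL' hL).
Qed.
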